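(* Let $(W,S)$ be a Coxeter system with $S$ finite and let $J\subseteq S$. Let $w\in{}^JW$ and $s\in S$ be such that $w<ws$ (in the right weak order) and $ws\in{}^JW$. Then $$A_R^J(ws)=[A_R^J(w),s]\sqcup\Delta_R^J(w,s),$$ where $\sqcup$ means that the union is disjoint.
   Context: Let $(W,S)$ be a Coxeter system with length function $\ell$, and let $T=\{wsw^{-1}\mid w\in W,\ s\in S\}$ be its set of reflections. Right weak order: $x\le y$ if some reduced expression of $y$ has a reduced expression of $x$ as a prefix, i.e. $\ell(y)=\ell(x)+\ell(x^{-1}y)$. For $s\in S$, $w<ws$ means $\ell(ws)=\ell(w)+1$. For $J\subseteq S$, ${}^JW=\{w\in W\mid \ell(rw)>\ell(w)\ \text{for all } r\in J\}$, the set of minimal length representatives of the cosets $W_Jw$, where $W_J=\langle J\rangle$. The right ascent set of $w$ is $A_R(w)=\{s\in S\mid \ell(ws)=\ell(w)+1\}$, and the right $J$-ascent set is $A_R^J(w)=\{s\in A_R(w)\mid ws\in{}^JW\}$. The right inversion set is $N_R(w)=\{t\in T\mid \ell(wt)<\ell(w)\}$. For $X\subseteq W$ and $y\in W$, $[X,y]:=\{x\in X\mid xy=yx,\ x\ne y\}$. For $w\in W$ and $s\in S$, $\Delta_R^J(w,s):=\{r\in S\mid wsr\in{}^JW,\ \ell(srs)=3,\ srs\notin N_R(w)\}$. Here the condition $\ell(srs)=3$ is equivalent to $rs\neq sr$. *)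

(* Defs.v *)
From mathcomp Require Import all_boot.
From mathcomp Require Import boolp classical_sets functions cardinality.

Set Implicit Arguments.
Unset Strict Implicit.
Unset Printing Implicit Defensive.

Local Open Scope classical_set_scope.
Local Open Scope group_scope.

Section CoxeterSystem.
Variable W : groupType.
Implicit Types (S J X : set W) (m : W -> W -> nat) (u v : seq W)
  (s t r w x y : W).

Definition word_in S u : Prop := forall s, s \in u -> S s.

(* Only the values of [m] on [S] matter, and [m s t = 0] encodes
   m(s,t) = infinity; hence off the diagonal [m s t] is 0 or at least 2. *)
Definition coxeter_matrix S m : Prop :=
  forall s t, S s -> S t -> (m s t = 1%N <-> s = t) /\ m s t = m t s.

(* The word (s t)^m(s,t); it is empty, i.e. imposes no relation, when
   m(s,t) = infinity. *)
Definition relator m s t : seq W := flatten (nseq (m s t) [:: s; t]).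

(* Congruence of the presentation < S | (s t)^m(s,t) = 1 >.  Since m(s,s) = 1
   makes every generator its own inverse, words in S suffice: formal inverses
   of letters are not needed. *)
Inductive presentation_eq S m : seq W -> seq W -> Prop :=
| pres_insert u v s t : word_in S u -> word_in S v -> S s -> S t ->
    presentation_eq S m (u ++ v) (u ++ relator m s t ++ v)
| pres_refl u : word_in S u -> presentation_eq S m u u
| pres_sym u v : presentation_eq S m u v -> presentation_eq S m v u
| pres_trans u v z : presentation_eq S m u v -> presentation_eq S m v z ->
    presentation_eq S m u z.

Definition expression S w u : Prop := word_in S u /\ \prod_(s <- u) s = w.

Definition coxeter_system S : Prop :=
  (forall w, exists u, expression S w u) /\
  exists m, coxeter_matrix S m /\
    forall u v, word_in S u -> word_in S v ->
      (\prod_(s <- u) s = \prod_(s <- v) s <-> presentation_eq S m u v).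

(* The least size of an expression of [w] in the generators [S]; the default
   value 0 is only reached when [w] has no expression. *)
Definition len S w : nat :=
  xget 0%N [set n | (exists2 u, expression S w u & size u = n) /\
                    forall u, expression S w u -> (n <= size u)%N].

Definition reduced_expression S w u : Prop :=
  expression S w u /\ size u = len S w.

Definition right_weak_le S x y : Prop :=
  exists u v, reduced_expression S x u /\ reduced_expression S y (u ++ v).

Definition right_weak_lt S x y : Prop := right_weak_le S x y /\ x <> y.

Definition reflections S : set W :=
  [set t | exists w, exists2 s, S s & t = w * s * w^-1].

Definition left_min_reps S J : set W :=
  [set w | forall r, J r -> (len S w < len S (r * w)%g)%N].

Definition right_ascents S w : set W :=
  [set s | S s /\ len S (w * s) = (len S w).+1].

Definition right_J_ascents S J w : set W :=
  [set s | right_ascents S w s /\ left_min_reps S J (w * s)].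

Definition right_inversions S w : set W :=
  [set t | reflections S t /\ (len S (w * t)%g < len S w)%N].

Definition commuting_others X y : set W :=
  [set x | X x /\ x * y = y * x /\ x <> y].

Definition Delta_R S J w s : set W :=
  [set r | S r /\ left_min_reps S J (w * s * r) /\
           len S (s * r * s) = 3%N /\ ~ right_inversions S w (s * r * s)].

End CoxeterSystem.

(* Main.v *)
Require Import Defs.
From mathcomp Require Import all_boot.
From mathcomp Require Import boolp classical_sets functions cardinality.

Set Implicit Arguments.
Unset Strict Implicit.
Unset Printing Implicit Defensive.

Local Open Scope classical_set_scope.
Local Open Scope group_scope.

(** The whole proof rests on one form of the exchange condition
    ([len_mull_split], with mirror image [len_mulr_split]): if a generator [r]
    shortens a product [a * b] by left multiplication, then either [r] already
    shortens [a], or the conjugate [a^-1 * r * a] shortens [b].  It comes from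
    the presentation.  A word [s_1 ... s_k] determines the reflections
    [s_1 ... s_(i-1) s_i s_(i-1) ... s_1]; left multiplication by one of them
    deletes a letter, and the parity of the number of times that a given
    reflection occurs is unchanged by the relations, since the list attached to
    [(s t)^m] is some list of length [m] repeated twice.  This parity therefore
    depends only on the element that the word represents, and it is odd at [r]
    when [r] shortens this element.  Lengths also have a well defined parity,
    so multiplication by a generator changes a length by exactly one.

    Now let [r <> s].  If [r] shortens [w * s], the exchange condition for the
    product [w * s] says that [s * r * s] shortens [w] ([right_descent_conj]).
    If [r] and [s] commute, then [s * r * s = r], so an ascent [r] of [w] is
    still an ascent of [w * s]; if they do not commute, [s * r * s] not being
    an inversion of [w] is exactly what keeps [r] an ascent of [w * s].  The
    converse inclusion follows from counting lengths along [w], [w * s],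
    [w * s * r], [w * s * r * s].  For minimality of coset representatives two
    facts suffice: they are closed under passing to prefixes
    ([left_min_reps_prefix]), and if [x] is one of them but some [j] in [J]
    shortens [x * r], then [j * x = x * r] ([left_min_reps_mulr]).  In the
    commuting case, if [j] shortened [w * s * r = w * r * s], this would apply
    both to [w * s] and to [w * r] with the same [j]; then
    [j * w * s = j * w * r], hence [r = s]. *)

(** * Reflections along a word *)

Section ReflectionSequence.
Variables (W : groupType).
Implicit Types (t x : W) (u v : seq W).

(** The entry of [s_1 ... s_k] at position [i] is
    [s_1 ... s_(i-1) s_i s_(i-1) ... s_1] when the letters are involutions:
    the reflection whose left multiplication cancels [s_i]. *)
Fixpoint reflection_seq u : seq W :=
  if u is a :: v then a :: [seq t ^ a^-1 | t <- reflection_seq v] else [::].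

Lemma reflection_seq_cat u v :
  reflection_seq (u ++ v) =
    reflection_seq u ++
      [seq t ^ (\prod_(a <- u) a)^-1 | t <- reflection_seq v].
Proof.
elim: u => [|a u IHu] /=.
  by rewrite big_nil -[LHS]map_id; apply: eq_map => t; rewrite invg1 conjg1.
rewrite IHu map_cat -map_comp; congr (_ :: _ ++ _).
by apply: eq_map => t /=; rewrite big_cons invgM conjgM.
Qed.

Lemma count_mem_conj t x (l : seq W) :
  count_mem t [seq y ^ x^-1 | y <- l] = count_mem (t ^ x) l.
Proof.
rewrite count_map; apply: eq_count => y /=.
by rewrite -(inj_eq (conjg_inj x)) conjgKV.
Qed.

Lemma prod_alternating x y n :
  \prod_(a <- flatten (nseq n [:: x; y])) a = (x * y) ^+ n.
Proof.
elim: n => [|n IHn] /=; first by rewrite big_nil.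
by rewrite !big_cons IHn expgS mulgA.
Qed.

Lemma size_alternating x y n : size (flatten (nseq n [:: x; y])) = n.*2.
Proof. by elim: n => //= n ->. Qed.

Lemma reflection_seq_alternating x y n : x * x = 1 -> y * y = 1 ->
  reflection_seq (flatten (nseq n [:: x; y])) =
    mkseq (fun j => (x * y) ^+ j * x) n.*2.
Proof.
move=> /mulg1_eq Vx /mulg1_eq Vy.
elim: n => [//|n IHn] /=; rewrite IHn /mkseq /= mul1g expg1.
congr [:: _, _ & _]; first by rewrite conjgE invgK Vx mulgA.
rewrite -!map_comp (iotaDl 2 0) -map_comp; apply: eq_map => j /=.
rewrite -conjgM -invgM conjgE invgK invgM Vx Vy.
by rewrite expgS expgSr -!mulgA.
Qed.

(** When [(x * y) ^+ m = 1], the reflections [(x * y) ^+ j * x] for [j < 2m]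
    repeat with period [m]. *)
Lemma count_reflection_seq_alternating x y m t :
    x * x = 1 -> y * y = 1 -> (x * y) ^+ m = 1 ->
  odd (count_mem t (reflection_seq (flatten (nseq m [:: x; y])))) = false.
Proof.
move=> xx yy xym; rewrite reflection_seq_alternating // /mkseq -addnn iotaD.
have -> : iota (0 + m) m = [seq (m + i)%N | i <- iota 0 m].
  by rewrite -iotaDl addn0.
rewrite map_cat count_cat -map_comp.
set l1 := map _ _; set l2 := map _ _; suff -> : l2 = l1 by rewrite oddD addbb.
by apply: eq_map => j /=; rewrite expgnDr xym mul1g.
Qed.

End ReflectionSequence.

(** * Length and the exchange condition *)

Section Length.
Variables (W : groupType) (S : set W).
Hypothesis cox : coxeter_system S.
Implicit Types (a b r s t w x y : W) (u v : seq W).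

Lemma expression_cat a b u v :
  expression S a u -> expression S b v -> expression S (a * b) (u ++ v).
Proof.
case=> [Su <-] [Sv <-]; split; last by rewrite big_cat.
by move=> x; rewrite mem_cat => /orP[/Su | /Sv].
Qed.

Lemma expression_gen s : S s -> expression S s [:: s].
Proof.
by move=> Ss; split; [move=> x; rewrite inE => /eqP-> | rewrite big_seq1].
Qed.

Lemma expression_cons s w u :
  S s -> expression S w u -> expression S (s * w) (s :: u).
Proof.
by move=> Ss; apply: (expression_cat (u := [:: s])); apply: expression_gen.
Qed.

Lemma gen_involution s : S s -> s * s = 1.
Proof.
move=> Ss; have [_ [m [mP prodP]]] := cox.
have m1 : m s s = 1%N by apply/(mP s s Ss Ss).1.
have: presentation_eq S m [::] [:: s; s].
  by have := @pres_insert W S m [::] [::] s s; rewrite /relator m1; apply.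
move/prodP; rewrite !big_cons !big_nil mulg1 => -> // x.
by rewrite !inE orbb => /eqP->.
Qed.

Lemma gen_inv s : S s -> s^-1 = s.
Proof. by move/gen_involution/mulg1_eq. Qed.

(** Inserting a relator adds an even number of letters and an even number of
    copies of any given reflection. *)
Lemma presentation_parity m u v t :
    (forall s r, S s -> S r -> (s * r) ^+ m s r = 1) ->
    presentation_eq S m u v ->
  odd (size u) = odd (size v) /\
  odd (count_mem t (reflection_seq u)) = odd (count_mem t (reflection_seq v)).
Proof.
move=> rel1; elim=> {u v} [u v s r _ _ Ss Sr | // | u v _ [-> ->] // |].
  rewrite /relator !size_cat !reflection_seq_cat map_cat !count_cat -map_comp.
  rewrite !oddD size_alternating odd_double addFb; split=> //; congr addb.
  rewrite [in RHS]count_mem_conj.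
  rewrite count_reflection_seq_alternating ?gen_involution ?rel1 // addFb.
  congr (odd (count _ _)); apply: eq_map => x /=.
  by rewrite prod_alternating rel1 // invg1 conjg1.
by move=> u v z _ [-> ->] _ [-> ->].
Qed.

Lemma expression_parity w u v t : expression S w u -> expression S w v ->
  odd (size u) = odd (size v) /\
  odd (count_mem t (reflection_seq u)) = odd (count_mem t (reflection_seq v)).
Proof.
move=> [Su <-] [Sv uv]; have [_ [m [mP prodP]]] := cox.
apply: (@presentation_parity m); last by apply/prodP.
move=> s r Ss Sr; rewrite -prod_alternating -[RHS](big_nil 1 *%g predT id).
apply/esym/prodP => //; last first.
  by have := @pres_insert W S m [::] [::] s r; rewrite /= cats0; apply.
by move=> x /flattenP[y]; rewrite mem_nseq => /andP[_ /eqP->];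
  rewrite !inE => /orP[]/eqP->.
Qed.

Lemma len_spec w :
  (exists2 u, expression S w u & size u = len S w) /\
  forall u, expression S w u -> (len S w <= size u)%N.
Proof.
have [gen _] := cox; have [u0 u0P] := gen w.
pose P n := `[< exists2 u, expression S w u & size u = n >].
have exP : exists n, P n by exists (size u0); apply/asboolP; exists u0.
pose Q := [set n | (exists2 u, expression S w u & size u = n) /\
                    forall u, expression S w u -> (n <= size u)%N].
suff: Q (len S w) by [].
apply: xgetPex; have [n /asboolP nP min_n] := ex_minnP exP.
by exists n; split=> // u uP; apply: min_n; apply/asboolP; exists u.
Qed.

Lemma exists_reduced w : exists u, reduced_expression S w u.
Proof. by have [[u uP usz] _] := len_spec w; exists u. Qed.

Lemma len_le_size w u : expression S w u -> (len S w <= size u)%N.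
Proof. exact: (len_spec w).2. Qed.

Lemma odd_size_expression w u :
  expression S w u -> odd (size u) = odd (len S w).
Proof.
have [v [vP <-]] := exists_reduced w.
by move=> uP; have [] := expression_parity 1 uP vP.
Qed.

Lemma len_eq0 w : len S w = 0%N -> w = 1.
Proof.
have [u [[_ <-] <-]] := exists_reduced w.
by move=> /size0nil->; rewrite big_nil.
Qed.

Lemma len_inv w : len S w^-1 = len S w.
Proof.
suff le x : (len S x^-1 <= len S x)%N.
  by apply/eqP; rewrite eqn_leq le -{1}[w]invgK le.
have [u [[Su <-] <-]] := exists_reduced x.
rewrite -(size_rev u); apply: len_le_size; split.
  by move=> y; rewrite mem_rev => /Su.
by apply: invg_inj; rewrite -prodgV invgK; apply: eq_big_seq => y /Su/gen_inv.
Qed.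

Lemma len_mul a b : (len S (a * b)%g <= len S a + len S b)%N.
Proof.
have [u [uP <-]] := exists_reduced a; have [v [vP <-]] := exists_reduced b.
by rewrite -size_cat; apply: len_le_size; apply: expression_cat.
Qed.

Lemma odd_len_mul a b : odd (len S (a * b)) = odd (len S a) (+) odd (len S b).
Proof.
have [u [uP <-]] := exists_reduced a; have [v [vP <-]] := exists_reduced b.
by rewrite -oddD -size_cat (odd_size_expression (expression_cat uP vP)).
Qed.

Lemma len_gen s : S s -> len S s = 1%N.
Proof.
move=> /expression_gen sP; have /= := odd_size_expression sP.
by have /= := len_le_size sP; case: (len S s) => [|[]].
Qed.

Lemma len_mulr_gen w s : S s ->
  len S (w * s) = (len S w).+1 \/ len S w = (len S (w * s)).+1.
Proof.
move=> Ss; have := odd_len_mul w s; have := len_mul w s.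
have := len_mul (w * s) s; rewrite -mulgA gen_involution // mulg1 (len_gen Ss).
rewrite !addn1 addbT; move: (len S w) (len S (w * s)) => k l.
case: (ltngtP l k) => [lt_lk le_k _ _ | lt_kl _ le_l _ | ->];
  last by case: odd.
  by right; apply/eqP; rewrite eqn_leq le_k.
by left; apply/eqP; rewrite eqn_leq le_l.
Qed.

Lemma len_mull_gen w s : S s ->
  len S (s * w) = (len S w).+1 \/ len S w = (len S (s * w)).+1.
Proof.
move=> Ss; have := len_mulr_gen w^-1 Ss.
by rewrite -(len_inv (w^-1 * s)) invgM invgK (gen_inv Ss) len_inv.
Qed.

(** Multiplying on the left by the reflection attached to a letter deletes that
    letter. *)
Lemma reflection_seq_shortens u t : word_in S u -> t \in reflection_seq u ->
  (len S (t * \prod_(a <- u) a)%g < size u)%N.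
Proof.
suff del : word_in S u -> t \in reflection_seq u ->
    exists2 v, expression S (t * \prod_(a <- u) a) v & (size v < size u)%N.
  by move=> Su /(del Su)[v /len_le_size le_v]; apply: leq_ltn_trans.
elim: u t => //= a u IHu t Sau.
have Sa : S a by apply: Sau; rewrite mem_head.
have Su : word_in S u by move=> x xu; apply: Sau; rewrite inE xu orbT.
rewrite big_cons inE => /orP[/eqP-> | /mapP[x xu ->]].
  by exists u => //; split=> //; rewrite mulgA gen_involution // mul1g.
have [v vP lt_v] := IHu x Su xu; exists (a :: v) => //.
have -> : x ^ a^-1 * (a * \prod_(j <- u) j) = a * (x * \prod_(j <- u) j).
  by rewrite conjgE invgK -!mulgA mulKg.
exact: expression_cons.
Qed.

(** A reduced word for [r * w] preceded by [r] is a word for [w] in which the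
    reflection [r] occurs once; by invariance of parity it occurs in every word
    for [w]. *)
Lemma left_descent_in_reflection_seq r w u :
    S r -> (len S (r * w)%g < len S w)%N -> expression S w u ->
  r \in reflection_seq u.
Proof.
move=> Sr lt_rw uP; have [v [vP v_sz]] := exists_reduced (r * w).
have rvP : expression S w (r :: v).
  by rewrite -[w]mul1g -(gen_involution Sr) -mulgA; apply: expression_cons.
have [_] := expression_parity r uP rvP.
have r_notin : r \notin [seq t ^ r^-1 | t <- reflection_seq v].
  apply/mapP => -[x xv /(congr1 (conjg^~ r))].
  rewrite conjgKV conjgE mulKg => rx; move: xv; rewrite -rx => rv.
  have [Sv v_prod] := vP; have := reflection_seq_shortens Sv rv.
  rewrite v_prod mulgA gen_involution // mul1g v_sz.
  by rewrite ltnNge ltnW.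
rewrite /= eqxx (count_memPn r_notin) addn0 /= => odd_r.
by rewrite -has_pred1 has_count; case: count odd_r.
Qed.

(** A word for [a * b] made of a word for [a] and a word for [b] carries the
    reflections of the first and the conjugates by [a] of those of the second;
    [r] has to be one of either kind. *)
Lemma len_mull_split r a b : S r ->
    (len S (r * (a * b))%g < len S (a * b)%g)%N ->
  (len S (r * a)%g < len S a)%N \/ (len S (r ^ a * b)%g < len S b)%N.
Proof.
have [u [uP <-]] := exists_reduced a; have [v [vP <-]] := exists_reduced b.
move=> Sr lt_rab.
have := left_descent_in_reflection_seq Sr lt_rab (expression_cat uP vP).
have [[Su u_prod] [Sv v_prod]] := (uP, vP).
rewrite reflection_seq_cat mem_cat => /orP[ru | /mapP[t tv ->]].
  by left; have := reflection_seq_shortens Su ru; rewrite u_prod.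
by right; have := reflection_seq_shortens Sv tv; rewrite u_prod v_prod conjgKV.
Qed.

Lemma len_mulr_split r a b : S r ->
    (len S (a * b * r)%g < len S (a * b)%g)%N ->
  (len S (b * r)%g < len S b)%N \/ (len S (a * r ^ b^-1)%g < len S a)%N.
Proof.
move=> Sr; have := @len_mull_split r b^-1 a^-1 Sr.
have -> : r * (b^-1 * a^-1) = (a * b * r)^-1 by rewrite !invgM (gen_inv Sr).
have -> : r * b^-1 = (b * r)^-1 by rewrite invgM (gen_inv Sr).
have -> : r ^ b^-1 * a^-1 = (a * r ^ b^-1)^-1.
  by rewrite invgM -conjVg (gen_inv Sr).
by rewrite -invgM !len_inv.
Qed.

(** Apply the exchange condition to [w * s]: the alternative that [r] shortens
    the single letter [s] means [r = s]. *)
Lemma right_descent_conj w s r : S s -> S r -> r <> s ->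
    (len S (w * s * r)%g < len S (w * s)%g)%N ->
  (len S (w * (s * r * s))%g < len S w)%N.
Proof.
move=> Ss Sr rs /(len_mulr_split Sr)[]; last first.
  by rewrite conjgE invgK (gen_inv Ss) !mulgA.
rewrite (len_gen Ss) ltnS leqn0 => /eqP/len_eq0/mulg1_eq.
by rewrite gen_inv // => /esym.
Qed.

(** Otherwise [s * r * s] would be shorter than [s * r], and
    [right_descent_conj] would force [s * r * s * r = 1]. *)
Lemma len_gen_conj s r :
  S s -> S r -> s * r <> r * s -> len S (s * r * s) = 3%N.
Proof.
move=> Ss Sr src.
have rs : r <> s by move=> rs; apply: src; rewrite rs.
have sr2 : len S (s * r) = 2%N.
  case: (len_mulr_gen s Sr); rewrite (len_gen Ss) => -[] //.
  by move=> /esym/len_eq0/mulg1_eq; rewrite gen_inv // => /esym.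
case: (len_mulr_gen (s * r) Ss); rewrite sr2 => // lt3.
have : (len S (s * r * s)%g < len S (s * r)%g)%N by rewrite sr2 lt3.
move/(right_descent_conj Sr Ss (not_eq_sym rs)).
rewrite (len_gen Ss) ltnS leqn0 => /eqP/len_eq0/mulg1_eq.
rewrite (gen_inv Ss) => srsr; case: src.
by rewrite {1}srsr -!mulgA (gen_involution Sr) mulg1.
Qed.

(** * Minimal left coset representatives *)

Variable J : set W.
Hypothesis JS : J `<=` S.

(** If [j] shortened [x], then [j * x * s] would be no longer than [x], so [j]
    would shorten [x * s] as well. *)
Lemma left_min_reps_prefix x s : S s -> len S (x * s) = (len S x).+1 ->
  left_min_reps S J (x * s) -> left_min_reps S J x.
Proof.
move=> Ss xs minxs j Jj; case: (len_mull_gen x (JS Jj)) => [-> //|lt_jx].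
have := leq_trans (minxs _ Jj) _; rewrite mulgA => /(_ _ (len_mul _ _)).
by rewrite xs (len_gen Ss) addn1 -lt_jx ltnNge leqnSn.
Qed.

Lemma not_left_min_reps x : ~ left_min_reps S J x ->
  exists2 j, J j & (len S (j * x)%g < len S x)%N.
Proof.
move=> /existsNP[j /not_implyP[Jj /negP]]; rewrite -leqNgt => le_jx.
exists j => //; case: (len_mull_gen x (JS Jj)) => E; last first.
  by rewrite [X in (_ < X)%N]E.
by move: le_jx; rewrite E ltnn.
Qed.

(** Deodhar's dichotomy: multiplying a minimal representative [x] by a
    generator [r] either gives a minimal representative again or stays in the
    coset of [x]. *)
Lemma left_min_reps_mulr x r j : S r -> J j -> left_min_reps S J x ->
  (len S (j * (x * r))%g < len S (x * r)%g)%N -> j * x = x * r.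
Proof.
move=> Sr Jj minx /(len_mull_split (JS Jj))[lt_jx | ].
  by have := ltn_trans (minx j Jj) lt_jx; rewrite ltnn.
rewrite (len_gen Sr) ltnS leqn0 => /eqP/len_eq0/mulg1_eq <-.
by rewrite -conjVg (gen_inv (JS Jj)) conjgC.
Qed.

Lemma right_weak_lt_len w s : S s -> right_weak_lt S w (w * s) ->
  len S (w * s) = (len S w).+1.
Proof.
move=> Ss [[u [v [[_ u_sz] [_ uv_sz]]]] _].
case: (len_mulr_gen w Ss) => // E.
by have := leq_addr (size v) (size u); rewrite -size_cat uv_sz u_sz E ltnn.
Qed.

End Length.

(** * Ascents after an ascent *)

Theorem theorem3p5 (W : groupType) (S J : set W) (w s : W)
  (hWS : coxeter_system S) (hfin : finite_set S) (hJ : J `<=` S)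
  (hw : left_min_reps S J w) (hs : S s)
  (hlt : right_weak_lt S w (w * s)) (hws : left_min_reps S J (w * s)) :
  right_J_ascents S J (w * s) =
    commuting_others (right_J_ascents S J w) s `|` Delta_R S J w s /\
  [disjoint commuting_others (right_J_ascents S J w) s & Delta_R S J w s].
Proof.
have ws_len := right_weak_lt_len hWS hs hlt.
have ss := gen_involution hWS hs.
split; last first.
  apply/eqP; rewrite -subset0 => r [[_ [rs _]] [Sr [_ [srs3 _]]]].
  by move: srs3; rewrite -rs -mulgA ss mulg1 (len_gen hWS Sr).
apply/seteqP; split=> r.
  case=> -[Sr wsr_len] min_wsr.
  have [sr|sr] := pselect (s * r = r * s); last first.
    right; split=> //; split=> //; split; first exact: len_gen_conj.
    (* [w * s * r * s] differs in length by one from [w * s * r], whose length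
       exceeds that of [w] by two, so it is longer than [w]. *)
    case=> _; have := len_mulr_gen hWS (w * s * r) hs.
    rewrite !mulgA wsr_len ws_len => -[-> | [<-]]; last first.
      by rewrite ltnNge leqnSn.
    by rewrite ltnNge -addn3 leq_addr.
  have wr_len : len S (w * r) = (len S w).+1.
    case: (len_mulr_gen hWS w Sr) => // E.
    have := len_mul hWS (w * r) s; rewrite -mulgA -sr mulgA wsr_len ws_len.
    by rewrite (len_gen hWS hs) addn1 -E ltnNge leqnSn.
  left; split; last first.
    split=> // rs; move: wsr_len; rewrite rs -mulgA ss mulg1 ws_len => /eqP.
    by rewrite -addn2 -[X in X == _]addn0 eqn_add2l.
  split=> //; apply: (left_min_reps_prefix hWS hJ hs).
    by rewrite -mulgA -sr mulgA wsr_len ws_len wr_len.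
  by rewrite -mulgA -sr mulgA.
case=> [[[[Sr wr_len] min_wr] [rs r_neq_s]] | [Sr [min_wsr [srs3 not_inv]]]].
  split.
    split=> //; case: (len_mulr_gen hWS (w * s) Sr) => // E.
    have := right_descent_conj hWS (w := w) hs Sr r_neq_s.
    rewrite -E => /(_ (leqnn _)).
    by rewrite -rs -mulgA ss mulg1 wr_len ltnNge leqnSn.
  apply: contrapT => /(not_left_min_reps hWS hJ)[j Jj lt_j].
  have jws := left_min_reps_mulr hWS hJ Sr Jj hws lt_j.
  have wrs : w * r * s = w * s * r by rewrite -!mulgA rs.
  (* The same [j] is a left descent of [w * r * s], and [w * r] is minimal. *)
  have jwr : j * (w * r) = w * r * s.
    by apply: (left_min_reps_mulr hWS hJ) => //; rewrite wrs.
  by apply/r_neq_s/(mulgI w)/(mulgI j); rewrite jwr jws.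
split=> //; split=> //; case: (len_mulr_gen hWS (w * s) Sr) => // E.
case: not_inv; split.
  by exists s; exists r => //; rewrite (gen_inv hWS hs).
apply: (right_descent_conj hWS) => //; last by rewrite E.
by move=> rs; move: srs3; rewrite rs ss mul1g (len_gen hWS hs).
Qed.
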